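(* Let $\ast$ be a contour in dimension $\ell$. (1) Let $\varphi\colon[0,\infty)^\ell\to[0,\infty)^\ell$ be an order isomorphism. (a) If $\ast$ is continuous and $\varphi$ is continuous in the standard topology, then the contour $\ast^\varphi$ is also continuous. (b) If $\ast$ is $C$-Lipschitz and $\varphi$ is $D$-Lipschitz with respect to $d_\infty$, then $\ast^\varphi$ is $CD$-Lipschitz. (2) Let $\Gamma\subset[0,\infty)^\ell$ be a finite subset. If $\ast$ is continuous (resp. $C$-Lipschitz), then so is $\ast_{/\Gamma}$. (3) Let $x$ be an element of $[0,\infty)^\ell_\infty$. If $\ast$ is continuous (resp. $C$-Lipschitz), then so is $\ast_{\vee x}$. (4) Let $f\colon[0,\infty)\to[0,\infty]$ be a contour type function. (a) If $\ast$ is continuous and $f(t)>0$ for all $t>0$, then the contour $\ast_f$ is also continuous. (b) If $\ast$ is $C$-Lipschitz and there is a real number $D$ such that $Df(t)\ge t$ for all $t>0$, then $\ast_f$ is $CD$-Lipschitz.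
   Context: Contours. $[0,\infty)^\ell$ is the poset of $\ell$-tuples of non-negative reals with the coordinatewise order; $[0,\infty)^\ell_\infty$ is obtained by adding a global maximum $\infty$; $\vee$ denotes the join. A contour in dimension $\ell$ is a function $\ast\colon[0,\infty)^\ell_\infty\times[0,\infty)\to[0,\infty)^\ell_\infty$ such that: (1) $v\le v\ast t$ for all $v,t$; (2) $v\ast s\le w\ast t$ whenever $v\le w$ and $s\le t$; (3) $(v\ast s)\ast t\le v\ast(s+t)$ for all $v,s,t$; (4) for all $v,w$, the set $\{t\in[0,\infty)\mid v\ast t\ge w\}$ is either empty or of the form $[a,\infty)$ with $a\in[0,\infty)$. Its step function is $\delta(v,w):=\inf\{t\in[0,\infty)\mid v\ast t\ge w\}\in[0,\infty]$ (with $\inf\emptyset=\infty$). Distances. $d_\infty(v,w)=\max_i|v_i-w_i|$ on $[0,\infty)^\ell$, inducing the standard topology. $K$ is a field; $\mathrm{tame}([0,\infty)^\ell,\mathrm{vec}_K)$ is the Abelian category of finitely presented functors from $[0,\infty)^\ell$ to finite dimensional $K$-vector spaces, i.e. cokernels of natural transformations between finite direct sums of the functors $K(v,-)$, where $K(v,x)=K$ if $v\le x$ and $0$ otherwise, with identity maps between nonzero values. The norm of $\ast$ is $N_\ast(X):=\inf\{t\in[0,\infty)\mid X(v\le v\ast t)=0\text{ for every }v\in[0,\infty)^\ell\text{ with }v\ast t<\infty\}$; for morphisms $N_\ast(f):=N_\ast(\ker f)+N_\ast(\mathrm{coker}f)$; $d_{N_\ast}(X,Y)$ is the infimum of $\sum_iN_\ast(f_i)$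 over all finite zig-zags $X=W_0\xrightarrow{f_1}W_1\xleftarrow{f_2}W_2\to\cdots\xleftarrow{f_l}W_l=Y$ of tame functors. On $[0,\infty)^\ell$ set $d_{N_\ast}(v,w):=d_{N_\ast}(K(v,-),K(w,-))$; the paper shows that this equals $\delta(v,w)+\delta(w,v)$. The contour $\ast$ is continuous if the identity function $([0,\infty)^\ell,d_\infty)\to([0,\infty)^\ell,d_{N_\ast})$ is continuous. For a real number $C$, it is $C$-Lipschitz if $C\,d_\infty(v,w)\ge d_{N_\ast}(v,w)$ for all $v,w\in[0,\infty)^\ell$. Constructions (each of which yields a contour). For an order isomorphism $\varphi$ of $[0,\infty)^\ell$ (a bijection with $v\le w$ iff $\varphi(v)\le\varphi(w)$), extended by $\varphi(\infty)=\infty$: $v\ast^\varphi t:=\varphi^{-1}(\varphi(v)\ast t)$. For finite $\Gamma\subset[0,\infty)^\ell$: $v\ast_{/\Gamma}t:=\infty$ if there is $x\in\Gamma$ with $v\ast t\ge x$, and $v\ast_{/\Gamma}t:=v\ast t$ otherwise. For $x\in[0,\infty)^\ell_\infty$: $v\ast_{\vee x}t:=(v\vee x)\ast t$. A function $f\colon[0,\infty)\to[0,\infty]$ is contour type if $f(s+t)\ge f(s)+f(t)$ for all $s,t$ and $\inf(f(T))=f(\inf(T))$ for every non-empty $T\subset[0,\infty)$; for such $f$: $v\ast_ft:=v\ast f(t)$ if $f(t)<\infty$, and $v\ast_ft:=\infty$ if $f(t)=\infty$. *)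

(* Defs.v *)
From HB Require Import structures.
From mathcomp Require Import all_boot all_order all_algebra.
From mathcomp Require Import interval_inference finmap.
From mathcomp Require Import all_classical all_reals ereal.

Set Implicit Arguments.
Unset Strict Implicit.
Unset Printing Implicit Defensive.

Import Order.TTheory GRing.Theory Num.Theory.
Local Open Scope classical_set_scope.
Local Open Scope ring_scope.

Section Complement.
Variables (K : fieldType) (V : vectType K) (U : {vspace V}).

Lemma sub_projv_compl (y : V) : y - projv U y \in (U^C)%VS.
Proof.
have yin : y \in (U + U^C)%VS by rewrite addv_complf memvf.
have e := daddv_pi_add (capv_compl U) yin.
have -> : y - projv U y = daddv_pi (U^C)%VS U y.
  by apply/eqP; rewrite subr_eq addrC; apply/eqP; exact: (esym e).
exact: memv_pi.
Qed.

Lemma projv_compl0 (y : V) : y \in (U^C)%VS -> projv U y = 0.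
Proof.
move=> yU; have yin : y \in (U + U^C)%VS by rewrite addv_complf memvf.
have dis : ((U^C)%VS :&: U = 0)%VS by rewrite capvC; exact: capv_compl.
have := daddv_pi_add (capv_compl U) yin.
rewrite (daddv_pi_id dis yU) => e.
by apply: (@addIr _ y); rewrite add0r.
Qed.

End Complement.

Section Functors.
Context {d : Order.disp_t} (T : porderType d) (K : fieldType).

Record vfunctor := VFunctor {
  vobj :> T -> vectType K;
  vmap : forall u v : T, (u <= v)%O -> 'Hom(vobj u, vobj v);
  vmap_id : forall (u : T) (h : (u <= u)%O) (x : vobj u), vmap h x = x;
  vmap_comp : forall (u v w : T) (huv : (u <= v)%O) (hvw : (v <= w)%O)
    (huw : (u <= w)%O) (x : vobj u), vmap hvw (vmap huv x) = vmap huw x }.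

Record vnat (X Y : vfunctor) := VNat {
  vcomp :> forall u : T, 'Hom(X u, Y u);
  vnatural : forall (u v : T) (h : (u <= v)%O) (x : X u),
    vcomp v (vmap X h x) = vmap Y h (vcomp u x) }.

Definition isomorphic (X Y : vfunctor) : Prop :=
  exists (f : vnat X Y) (g : vnat Y X),
    (forall u, cancel (f u) (g u)) /\ (forall u, cancel (g u) (f u)).

Section KerCoker.
Variables (X Y : vfunctor) (f : vnat X Y).

Let kobj (u : T) : vectType K := subvs_of (lker (f u)).

Let kmap (u v : T) (h : (u <= v)%O) : 'Hom(kobj u, kobj v) :=
  (linfun (vsproj (lker (f v))) \o (vmap X h \o linfun vsval))%VF.

Let kmapE u v (h : (u <= v)%O) (x : kobj u) :
  vsval (kmap h x) = vmap X h (vsval x).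
Proof.
rewrite /kmap !comp_lfunE !lfunE /= vsprojK //.
by rewrite memv_ker vnatural; have := subvsP x; rewrite memv_ker => /eqP ->; rewrite linear0.
Qed.

Let kmap_id u (h : (u <= u)%O) x : kmap h x = x.
Proof. by apply: val_inj; rewrite /= kmapE vmap_id. Qed.

Let kmap_comp u v w (huv : (u <= v)%O) (hvw : (v <= w)%O) (huw : (u <= w)%O) x :
  kmap hvw (kmap huv x) = kmap huw x.
Proof. by apply: val_inj; rewrite /= !kmapE (vmap_comp _ _ huw). Qed.

Definition vker : vfunctor := VFunctor kmap_id kmap_comp.

Lemma vkerE (u v : T) (h : (u <= v)%O) (x : vker u) :
  vsval (vmap vker h x) = vmap X h (vsval x).
Proof. exact: kmapE. Qed.

(* The quotient of Y u by the image of f u is carried by the complement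
   (limg (f u))^C: the class of y is represented by y - projv (limg (f u)) y. *)
Let cobj (u : T) : vectType K := subvs_of ((limg (f u))^C)%VS.

Let cproj (u : T) : 'Hom(Y u, cobj u) :=
  (linfun (vsproj ((limg (f u))^C)%VS) \o (\1 - projv (limg (f u))))%VF.

Let cmap (u v : T) (h : (u <= v)%O) : 'Hom(cobj u, cobj v) :=
  (cproj v \o (vmap Y h \o linfun vsval))%VF.

Let cprojE u y : vsval (cproj u y) = y - projv (limg (f u)) y.
Proof.
rewrite /cproj comp_lfunE lfunE /= add_lfunE opp_lfunE id_lfunE vsprojK //.
exact: sub_projv_compl.
Qed.

Let cproj_img u y : y \in limg (f u) -> cproj u y = 0.
Proof.
by move=> yU; apply: val_inj; rewrite /= cprojE projv_id // subrr.
Qed.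

Let cmapE u v (h : (u <= v)%O) (y : Y u) :
  cmap h (cproj u y) = cproj v (vmap Y h y).
Proof.
have -> z : cmap h z = cproj v (vmap Y h (vsval z)).
  by rewrite /cmap comp_lfunE; congr (cproj v _); rewrite comp_lfunE lfunE.
rewrite cprojE.
rewrite linearB linearB /= [X in _ - X]cproj_img ?subr0 //.
have /memv_imgP[x _ ->] := memv_proj (limg (f u)) y.
by rewrite -vnatural memv_img ?memvf.
Qed.

Let cprojK u (x : cobj u) : cproj u (vsval x) = x.
Proof.
by apply: val_inj; rewrite /= cprojE (projv_compl0 (subvsP x)) subr0.
Qed.

Let cmap_id u (h : (u <= u)%O) x : cmap h x = x.
Proof. by rewrite -(cprojK x) cmapE vmap_id. Qed.

Let cmap_comp u v w (huv : (u <= v)%O) (hvw : (v <= w)%O) (huw : (u <= w)%O) x :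
  cmap hvw (cmap huv x) = cmap huw x.
Proof. by rewrite -(cprojK x) !cmapE (vmap_comp _ _ huw). Qed.

Definition vcoker : vfunctor := VFunctor cmap_id cmap_comp.

Lemma vcokerE (u v : T) (h : (u <= v)%O) (x : vcoker u) :
  vsval (vmap vcoker h x) =
  vmap Y h (vsval x) - projv (limg (f v)) (vmap Y h (vsval x)).
Proof. by rewrite -cprojE -(cmapE h) cprojK. Qed.

End KerCoker.

(* 'rV[K]_b is a copy of K if b is true, and 0 if b is false; the 1 x 1 matrix
   const_mx 1 is the identity. *)
Section Free.
Variable g : T.

Let fobj (u : T) : vectType K := 'rV[K]_(g <= u)%O.

Let fmap (u v : T) (h : (u <= v)%O) : 'Hom(fobj u, fobj v) :=
  linfun (mulmxr (const_mx 1 : 'M[K]_((g <= u)%O, (g <= v)%O))).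

Let fmap_id u (h : (u <= u)%O) (x : fobj u) : fmap h x = x.
Proof.
rewrite lfunE /= -[RHS]mulmx1; congr mulmx.
by move: (g <= u)%O => [] {x}; apply/matrixP => [[[|//] i] [[|//] j]]; rewrite !mxE.
Qed.

Let fmap_comp u v w (huv : (u <= v)%O) (hvw : (v <= w)%O) (huw : (u <= w)%O)
  (x : fobj u) : fmap hvw (fmap huv x) = fmap huw x.
Proof.
rewrite !lfunE /= -mulmxA; congr mulmx; apply/matrixP => i j; rewrite !mxE.
have gu : (g <= u)%O by case: (g <= u)%O i => // -[].
rewrite (eq_bigr (fun=> 1)) => [|k _]; last by rewrite !mxE mulr1.
by rewrite sumr_const card_ord (le_trans gu huv).
Qed.

Definition free_functor : vfunctor := VFunctor fmap_id fmap_comp.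

Lemma free_functorE (u v : T) (h : (u <= v)%O) (x : free_functor u) :
  vmap free_functor h x = x *m const_mx 1.
Proof. by rewrite lfunE. Qed.

End Free.

Section Zero.

Let zobj (u : T) : vectType K := 'rV[K]_0.
Let zmap (u v : T) (h : (u <= v)%O) : 'Hom(zobj u, zobj v) := \1%VF.
Let zmap_id u (h : (u <= u)%O) (x : zobj u) : zmap h x = x.
Proof. exact: id_lfunE. Qed.
Let zmap_comp u v w (huv : (u <= v)%O) (hvw : (v <= w)%O) (huw : (u <= w)%O)
  (x : zobj u) : zmap hvw (zmap huv x) = zmap huw x.
Proof. by rewrite !id_lfunE. Qed.

Definition vzero : vfunctor := VFunctor zmap_id zmap_comp.

End Zero.

Section DirectSum.
Variables X Y : vfunctor.

Let sobj (u : T) : vectType K := (X u * Y u)%type.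

Let smap_fun (u v : T) (h : (u <= v)%O) (x : sobj u) : sobj v :=
  (vmap X h x.1, vmap Y h x.2).

Let smap_linear u v (h : (u <= v)%O) : linear (smap_fun h).
Proof. by move=> a x y; rewrite /smap_fun /= !linearP. Qed.

Let smap (u v : T) (h : (u <= v)%O) : 'Hom(sobj u, sobj v) :=
  linfun (smap_fun h).

Let smapE u v (h : (u <= v)%O) x : smap h x = smap_fun h x.
Proof.
pose L : {linear sobj u -> sobj v} :=
  HB.pack (smap_fun h) (GRing.isLinear.Build _ _ _ _ _ (smap_linear h)).
exact: (lfunE L x).
Qed.

Let smap_id u (h : (u <= u)%O) (x : sobj u) : smap h x = x.
Proof. by rewrite smapE /smap_fun !vmap_id; case: x. Qed.

Let smap_comp u v w (huv : (u <= v)%O) (hvw : (v <= w)%O) (huw : (u <= w)%O)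
  (x : sobj u) : smap hvw (smap huv x) = smap huw x.
Proof. by rewrite !smapE /smap_fun /= !(vmap_comp _ _ huw). Qed.

Definition vsum : vfunctor := VFunctor smap_id smap_comp.

Lemma vsumE (u v : T) (h : (u <= v)%O) (x : vsum u) :
  vmap vsum h x = (vmap X h x.1, vmap Y h x.2).
Proof. exact: smapE. Qed.

End DirectSum.

Definition free_sum (s : seq T) : vfunctor :=
  foldr (fun g X => vsum (free_functor g) X) vzero s.

Definition tame (X : vfunctor) : Prop :=
  exists (rels gens : seq T) (p : vnat (free_sum rels) (free_sum gens)),
    isomorphic X (vcoker p).

End Functors.

Section Contours.
Variables (R : realType) (l : nat).

(* tupleprod carries the product order on tuples. *)
Definition orthant := l.-tupleprod {nonneg R}.

(* None is the global maximum. *)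
Definition orthantoo := option orthant.

Definition leoo (v w : orthantoo) : bool :=
  match v, w with
  | _, None => true
  | None, Some _ => false
  | Some v', Some w' => (v' <= w')%O
  end.

Definition joinoo (v w : orthantoo) : orthantoo :=
  match v, w with
  | Some v', Some w' => Some (v' `|` w')%O
  | _, _ => None
  end.

Lemma leoo_refl v : leoo v v. Proof. by case: v => /=. Qed.

Lemma leoo_trans w v x : leoo v w -> leoo w x -> leoo v x.
Proof. by case: v w x => [v|] [w|] [x|] //=; apply: le_trans. Qed.

Lemma leoo_joinl v x : leoo v (joinoo v x).
Proof. by case: v x => [v|] [x|] //=; rewrite leUl. Qed.

Lemma leoo_joinr v x : leoo x (joinoo v x).
Proof. by case: v x => [v|] [x|] //=; rewrite leUr. Qed.

Lemma leoo_join v w x : leoo (joinoo v x) w = leoo v w && leoo x w.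
Proof.
by case: v x w => [v|] [x|] [w|] //=; rewrite ?leUx ?andbF ?andbT.
Qed.

Record contour := Contour {
  act :> orthantoo -> {nonneg R} -> orthantoo;
  act_ge : forall v t, leoo v (act v t);
  act_mono : forall v w s t, leoo v w -> s <= t -> leoo (act v s) (act w t);
  act_lax : forall v s t,
    leoo (act (act v s) t) (act v (s%:num + t%:num)%:nng);
  act_closed : forall v w, [set t | leoo w (act v t)] = set0 \/
    exists a : {nonneg R}, [set t | leoo w (act v t)] = [set t | a <= t] }.

Definition dinfty (v w : orthant) : R :=
  \big[Num.max/0]_(i < l) `|(tnth v i)%:num - (tnth w i)%:num|.

Definition edinfty (v w : orthant) : \bar R := (dinfty v w)%:E.

(* edinfty induces the standard topology, so continuity with respect to it is
   topological continuity. *)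
Definition continuous_wrt (d1 d2 : orthant -> orthant -> \bar R)
    (f : orthant -> orthant) : Prop :=
  forall (v : orthant) (e : R), 0 < e -> exists2 b : R, 0 < b &
    forall w : orthant, (d1 v w < b%:E)%E -> (d2 (f v) (f w) < e%:E)%E.

Definition lipschitz_dinfty (D : R) (f : orthant -> orthant) : Prop :=
  forall v w : orthant, dinfty (f v) (f w) <= D * dinfty v w.

Section Distance.
Variables (K : fieldType) (c : contour).
Local Open Scope ereal_scope.

Definition functor_norm (X : vfunctor orthant K) : \bar R :=
  ereal_inf [set (t%:num)%:E | t in
    [set t : {nonneg R} | forall (v u : orthant) (h : (v <= u)%O),
       c (Some v) t = Some u -> vmap X h = 0%R]].

Definition hom_norm (X Y : vfunctor orthant K) (f : vnat X Y) : \bar R :=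
  functor_norm (vker f) + functor_norm (vcoker f).

(* zigzag X Y r: some zig-zag X -> W1 <- W2 -> ... <- Y of tame functors has
   total cost r. *)
Inductive zigzag : vfunctor orthant K -> vfunctor orthant K -> \bar R -> Prop :=
| zigzag_nil (X : vfunctor orthant K) : tame X -> zigzag X X 0
| zigzag_cons (W0 W1 W2 Y : vfunctor orthant K) (r : \bar R)
    (f1 : vnat W0 W1) (f2 : vnat W2 W1) :
    tame W0 -> tame W1 -> zigzag W2 Y r ->
    zigzag W0 Y (hom_norm f1 + (hom_norm f2 + r)).

Definition functor_dist (X Y : vfunctor orthant K) : \bar R :=
  ereal_inf [set r | zigzag X Y r].

Definition orthant_dist (v w : orthant) : \bar R :=
  functor_dist (free_functor K v) (free_functor K w).

Definition continuous_contour : Prop :=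
  continuous_wrt edinfty orthant_dist id.

Definition lipschitz_contour (C : R) : Prop :=
  forall v w : orthant, orthant_dist v w <= (C * dinfty v w)%:E.

End Distance.

Record order_iso := OrderIso {
  iso_fun :> orthant -> orthant;
  iso_inv : orthant -> orthant;
  iso_funK : cancel iso_fun iso_inv;
  iso_invK : cancel iso_inv iso_fun;
  iso_le : forall v w, (iso_fun v <= iso_fun w)%O = (v <= w)%O }.

Section Conjugate.
Variables (phi : order_iso) (c : contour).

Definition conj_act (v : orthantoo) (t : {nonneg R}) : orthantoo :=
  omap (iso_inv phi) (c (omap phi v) t).

Let leoo_phi v w : leoo (omap phi v) (omap phi w) = leoo v w.
Proof. by case: v w => [v|] [w|] //=; rewrite iso_le. Qed.

Let invK v : omap phi (omap (iso_inv phi) v) = v.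
Proof. by case: v => //= v; rewrite iso_invK. Qed.

Let conj_ge v t : leoo v (conj_act v t).
Proof. by rewrite -leoo_phi invK act_ge. Qed.

Let conj_mono v w s t :
  leoo v w -> s <= t -> leoo (conj_act v s) (conj_act w t).
Proof. by move=> vw st; rewrite -leoo_phi !invK act_mono ?leoo_phi. Qed.

Let conj_lax v s t :
  leoo (conj_act (conj_act v s) t) (conj_act v (s%:num + t%:num)%:nng).
Proof. by rewrite -leoo_phi /conj_act !invK act_lax. Qed.

Let conj_closed v w : [set t | leoo w (conj_act v t)] = set0 \/
  exists a : {nonneg R}, [set t | leoo w (conj_act v t)] = [set t | a <= t].
Proof.
suff -> : [set t | leoo w (conj_act v t)] =
  [set t | leoo (omap phi w) (c (omap phi v) t)] by exact: act_closed.
by apply/seteqP; split => t /=; rewrite -(leoo_phi w (conj_act v t)) /conj_act invK.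
Qed.

Definition contour_conj : contour :=
  Contour conj_ge conj_mono conj_lax conj_closed.

End Conjugate.

Section Truncate.
Variables (G : {fset orthant}) (c : contour).

Definition trunc_act (v : orthantoo) (t : {nonneg R}) : orthantoo :=
  if has (fun x => leoo (Some x) (c v t)) G then None else c v t.

Let act_trunc v t : leoo (c v t) (trunc_act v t).
Proof. by rewrite /trunc_act; case: ifP => _ //; [case: (c v t) | exact: leoo_refl]. Qed.

Let trunc_ge v t : leoo v (trunc_act v t).
Proof. exact: leoo_trans (act_ge c v t) (act_trunc v t). Qed.

Let trunc_mono v w s t :
  leoo v w -> s <= t -> leoo (trunc_act v s) (trunc_act w t).
Proof.
move=> vw st; have le := act_mono c vw st.
rewrite {2}/trunc_act; case: ifPn => [_|nG]; first by case: (trunc_act v s).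
rewrite /trunc_act ifN //; apply: contra nG => /hasP[x xG xv].
by apply/hasP; exists x => //; exact: leoo_trans le.
Qed.

Let trunc_lax v s t :
  leoo (trunc_act (trunc_act v s) t) (trunc_act v (s%:num + t%:num)%:nng).
Proof.
rewrite {3}/trunc_act; case: ifPn => [_|nG]; first by case: (trunc_act _ t).
have nG' u : leoo u (c v (s%:num + t%:num)%:nng) ->
    has (fun x => leoo (Some x) u) G = false.
  move=> uv; apply/negbTE; apply: contra nG => /hasP[x xG xu].
  by apply/hasP; exists x => //; exact: leoo_trans uv.
have e : trunc_act v s = c v s.
  by rewrite /trunc_act nG' //; exact: leoo_trans (act_ge c _ t) (act_lax c v s t).
by rewrite e /trunc_act nG' //; exact: act_lax.
Qed.

Let trunc_closed v w : [set t | leoo w (trunc_act v t)] = set0 \/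
  exists a : {nonneg R}, [set t | leoo w (trunc_act v t)] = [set t | a <= t].
Proof.
have -> : [set t | leoo w (trunc_act v t)] =
    [set t | leoo w (c v t) || has (fun x => leoo (Some x) (c v t)) G].
  apply/seteqP; split => t /=; rewrite /trunc_act.
    by case: ifP => _; rewrite ?orbT ?orbF.
  by case: ifP; rewrite ?orbF //; case: w.
elim: (enum_fset G) w => [|x s IHs] w /=.
  have -> : [set t | leoo w (c v t) || false] = [set t | leoo w (c v t)].
    by apply/seteqP; split => t /=; rewrite orbF.
  exact: act_closed.
have -> : [set t | [|| leoo w (c v t), leoo (Some x) (c v t)
                     | has (fun y => leoo (Some y) (c v t)) s]] =
    [set t | leoo (Some x) (c v t)] `|`
    [set t | leoo w (c v t) || has (fun y => leoo (Some y) (c v t)) s].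
  apply/seteqP; split => t /=; first by move=> /or3P[]; auto; move=> ->; rewrite ?orbT; auto.
  by move=> [->|/orP[] ->]; rewrite ?orbT.
case: (act_closed c v (Some x)) => [->|[a ->]]; first by rewrite set0U.
case: (IHs w) => [->|[b ->]]; first by right; exists a; rewrite setU0.
right; exists (Order.min a b); apply/seteqP; split => t /=.
  by rewrite ge_min => -[] ->; rewrite ?orbT.
by rewrite ge_min => /orP[]; auto.
Qed.

Definition contour_trunc : contour :=
  Contour trunc_ge trunc_mono trunc_lax trunc_closed.

End Truncate.

Section JoinContour.
Variables (x : orthantoo) (c : contour).

Definition join_act (v : orthantoo) (t : {nonneg R}) : orthantoo :=
  c (joinoo v x) t.

Let join_ge v t : leoo v (join_act v t).
Proof. exact: leoo_trans (leoo_joinl v x) (act_ge c _ t). Qed.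

Let join_mono v w s t :
  leoo v w -> s <= t -> leoo (join_act v s) (join_act w t).
Proof.
move=> vw; apply: act_mono; rewrite leoo_join leoo_joinr andbT.
exact: leoo_trans vw (leoo_joinl w x).
Qed.

Let join_lax v s t :
  leoo (join_act (join_act v s) t) (join_act v (s%:num + t%:num)%:nng).
Proof.
apply: leoo_trans (act_lax c (joinoo v x) s t); apply: act_mono => //.
rewrite leoo_join leoo_refl /=.
exact: leoo_trans (leoo_joinr v x) (act_ge c _ s).
Qed.

Let join_closed v w : [set t | leoo w (join_act v t)] = set0 \/
  exists a : {nonneg R}, [set t | leoo w (join_act v t)] = [set t | a <= t].
Proof. exact: act_closed. Qed.

Definition contour_join : contour :=
  Contour join_ge join_mono join_lax join_closed.

End JoinContour.

Lemma nng_inf_ge0 (S : set {nonneg R}) : 0 <= inf [set t%:num | t in S].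
Proof.
have [->|S0] := eqVneq S set0; first by rewrite image_set0 inf0.
apply: lb_le_inf; first by case/set0P: S0 => t St; exists t%:num, t.
by move=> _ [t _ <-].
Qed.

Definition nng_inf (S : set {nonneg R}) : {nonneg R} := NngNum (nng_inf_ge0 S).

Record contour_type (f : {nonneg R} -> \bar R) : Prop := ContourType {
  ctype_ge0 : forall t, (0 <= f t)%E;
  ctype_superadd : forall s t, (f s + f t <= f (s%:num + t%:num)%:nng%R)%E;
  ctype_inf : forall S : set {nonneg R}, S !=set0 ->
    ereal_inf (f @` S) = f (nng_inf S) }.

Section Reparametrize.
Variables (f : {nonneg R} -> \bar R) (hf : contour_type f) (c : contour).

Definition repar_act (v : orthantoo) (t : {nonneg R}) : orthantoo :=
  if f t == +oo%E then None else c v (NngNum (fine_ge0 (ctype_ge0 hf t))).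

Let f_mono s t : s <= t -> (f s <= f t)%E.
Proof.
move=> st; have st' : 0 <= t%:num - s%:num by rewrite subr_ge0.
have := ctype_superadd hf s (NngNum st').
have -> : (s%:num + (NngNum st')%:num)%:nng = t.
  by apply: val_inj => /=; rewrite addrC subrK.
by apply: le_trans; rewrite leeDl // ctype_ge0.
Qed.

Let f_fin t : f t != +oo%E -> (f t \is a fin_num).
Proof. by move=> h; rewrite ge0_fin_numE ?ctype_ge0 // lt_neqAle h leey. Qed.

Let repar_ge v t : leoo v (repar_act v t).
Proof. by rewrite /repar_act; case: ifP => _; [case: v | exact: act_ge]. Qed.

Let repar_mono v w s t :
  leoo v w -> s <= t -> leoo (repar_act v s) (repar_act w t).
Proof.
move=> vw st; rewrite {2}/repar_act; case: ifPn => [_|ft]; first by case: (repar_act v s).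
have fs : f s != +oo%E.
  by apply: contra ft => /eqP fs; rewrite eq_le leey -fs f_mono.
rewrite /repar_act ifN //; apply: act_mono => //.
by rewrite -num_le /=; apply: fine_le; rewrite ?f_fin ?f_mono.
Qed.

Let repar_lax v s t :
  leoo (repar_act (repar_act v s) t) (repar_act v (s%:num + t%:num)%:nng).
Proof.
rewrite {3}/repar_act; case: ifPn => [_|fst]; first by case: (repar_act _ t).
have fs : f s != +oo%E.
  apply: contra fst => /eqP fs; rewrite eq_le leey -fs f_mono //.
  by rewrite -num_le /= lerDl.
have ft : f t != +oo%E.
  apply: contra fst => /eqP ft; rewrite eq_le leey -ft f_mono //.
  by rewrite -num_le /= lerDr.
rewrite /repar_act (negbTE fs) (negbTE ft).
apply: leoo_trans (act_lax c v _ _) _; apply: act_mono; first exact: leoo_refl.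
rewrite -num_le /= -fineD ?f_fin //; apply: fine_le.
- by rewrite fin_numD !f_fin.
- exact: f_fin.
- exact: ctype_superadd.
Qed.

Let repar_closed v w : [set t | leoo w (repar_act v t)] = set0 \/
  exists a : {nonneg R}, [set t | leoo w (repar_act v t)] = [set t | a <= t].
Proof.
set S := [set t | _].
have [->|/set0P S0] := eqVneq S set0; [by left | right].
have Sup t : S t -> nng_inf S <= t.
  move=> St; rewrite -num_le /=; apply: ge_inf; last by exists t.
  by exists 0 => _ [r _ <-].
exists (nng_inf S); apply/seteqP; split => t /=; first exact: Sup.
suff Sinf : S (nng_inf S).
  by move=> le; apply: leoo_trans Sinf _; apply: repar_mono => //; exact: leoo_refl.
have fS := ctype_inf hf S0.
rewrite /S /= /repar_act; case: ifPn => [_|fi]; first by case: w {S S0 Sup fS}.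
have [e|[a e]] := act_closed c v w.
  suff fe : f (nng_inf S) = +oo%E by rewrite fe eqxx in fi.
  rewrite -fS; apply/eqP; rewrite eq_le leey /=; apply: le_ereal_inf_tmp.
  move=> _ [r Sr <-]; move: Sr; rewrite /S /= /repar_act.
  case: ifPn => [/eqP -> //|_ wr].
  by have : set0 (NngNum (fine_ge0 (ctype_ge0 hf r))) by rewrite -e.
suff af : (a%:num%:E <= f (nng_inf S))%E.
  have : [set t | a <= t] (NngNum (fine_ge0 (ctype_ge0 hf (nng_inf S)))).
    by rewrite /= -num_le /= -lee_fin fineK // f_fin.
  by rewrite -e.
rewrite -fS; apply: le_ereal_inf_tmp => _ [r Sr <-].
move: Sr; rewrite /S /= /repar_act; case: ifPn => [/eqP ->|fr wr]; first by rewrite leey.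
have : [set t | a <= t] (NngNum (fine_ge0 (ctype_ge0 hf r))) by rewrite -e.
by rewrite /= -num_le /= -lee_fin fineK // f_fin.
Qed.

Definition contour_repar : contour :=
  Contour repar_ge repar_mono repar_lax repar_closed.

End Reparametrize.

End Contours.

(* Main.v *)
Require Import Defs.
From HB Require Import structures.
From mathcomp Require Import all_boot all_order all_algebra.
From mathcomp Require Import interval_inference finmap.
From mathcomp Require Import all_classical all_reals ereal.
From mathcomp Require Import ring lra.

Set Implicit Arguments.
Unset Strict Implicit.
Unset Printing Implicit Defensive.

Import Order.TTheory GRing.Theory Num.Theory.
Local Open Scope ring_scope.

(* The distance between the free functors on v and w is delta(v, w) +
   delta(w, v), where delta is the step function; each of the four claims is
   then an elementary comparison of step functions.
   The bound from above is the zig-zag K(v) <- K(v \/ w) -> K(w).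
   For the bound from below, a zig-zag from X to Y is composed into a relation
   between X u and Y u.  Every x in X v, moved to v * t with t the sum of the
   cokernel norms of the backward arrows, is related to some y; and an x related
   to 0 vanishes after k, the sum of the kernel norms of the forward arrows.
   Applied to the generator of K(v), this forces v * (t + k) >= w.  The
   converse relation uses the remaining half of the norms, so that the two
   estimates together cost exactly the length of the zig-zag. *)

(** * Free functors, and kernels and cokernels at a single arrow *)

Section FreeFunctors.
Context {d : Order.disp_t} (T : porderType d) (K : fieldType).
Implicit Types (g h u v : T) (X Y : vfunctor T K).

(** Each entry of the product is the inner size [b] read as a scalar. If [b] is false, the
    hypothesis makes [a] false too, and both sides are empty matrices. *)
Lemma mul_const_mx1 (a b c : bool) : (a -> b) ->
  (const_mx 1 : 'M[K]_(a, b)) *m (const_mx 1 : 'M[K]_(b, c)) = const_mx 1.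
Proof.
move=> ab; apply/matrixP => i j; rewrite !mxE.
have bT : b by apply: ab; case: (a) i => // -[].
rewrite (eq_bigr (fun=> 1)) => [|k _]; last by rewrite !mxE mulr1.
by rewrite sumr_const card_ord bT.
Qed.

Lemma free_functor_eq0 g u (x : free_functor K g u) : ~~ (g <= u)%O -> x = 0.
Proof.
move=> gu; apply/matrixP => i j; case: (negP gu).
by case: (g <= u)%O j => // -[].
Qed.

Lemma free_functor_id g u (x : free_functor K g u) :
  (x : 'rV[K]_(g <= u)%O) *m (const_mx 1 : 'M[K]_((g <= u)%O, (g <= u)%O)) = x.
Proof.
have := free_functorE (lexx u) x; rewrite vmap_id => {2}->; reflexivity.
Qed.

(** Total in [u]: outside the support of the functor the matrix is empty, hence zero. *)
Definition free_gen g u : free_functor K g u := const_mx 1.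

Lemma vmap_free_gen g u v (uv : (u <= v)%O) : (g <= u)%O ->
  vmap (free_functor K g) uv (free_gen g u) <> 0.
Proof.
move=> gu /matrixP.
rewrite free_functorE /free_gen.
have [gv] : (0 < (g <= v)%O)%N by rewrite (le_trans gu uv).
move=> /(_ ord0 (Ordinal gv)) /eqP; apply/negP; rewrite !mxE.
rewrite (eq_bigr (fun=> 1)) => [|k _]; last by rewrite !mxE mulr1.
by rewrite sumr_const card_ord gu oner_neq0.
Qed.

Definition vnat_id X : vnat X X.
Proof. by exists (fun u => \1%VF) => u v h x; rewrite !id_lfunE. Defined.

Section KernelCokernel.
Variables (X Y : vfunctor T K) (f : vnat X Y) (u v : T) (uv : (u <= v)%O).

Lemma vmap_vker_eq0 x : vmap (vker f) uv = 0 -> f u x = 0 -> vmap X uv x = 0.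
Proof.
move=> f0 /eqP; rewrite -memv_ker => xk.
by have := vkerE uv (Subvs xk : vker f u); rewrite f0 zero_lfunE /= => <-.
Qed.

Lemma vmap_vker0 : (forall x, f u x = 0 -> x = 0) -> vmap (vker f) uv = 0.
Proof.
move=> f0; apply/lfunP => x; rewrite zero_lfunE; apply: val_inj.
apply: (etrans (vkerE _ _)); rewrite (f0 (vsval x)) ?linear0 //.
by apply/eqP; rewrite -memv_ker subvsP.
Qed.

(** Split [y] into a part in the chosen complement and a part in the image of [f u]. The first
    represents the class of [y] in the cokernel and lands in the image because that class dies; the
    second stays in the image by naturality. *)
Lemma vmap_vcoker_img y : vmap (vcoker f) uv = 0 -> vmap Y uv y \in limg (f v).
Proof.
move=> f0; have yc := sub_projv_compl (limg (f u)) y.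
have := vcokerE uv (Subvs yc : vcoker f u).
rewrite f0 zero_lfunE /= => /esym/eqP; rewrite subr_eq0 linearB subr_eq => /eqP ->.
rewrite memvD ?memv_proj //=.
have /memv_imgP[x _ ->] := memv_proj (limg (f u)) y.
by rewrite -vnatural memv_img ?memvf.
Qed.

Lemma vmap_vcoker0 : (forall y, vmap Y uv y \in limg (f v)) ->
  vmap (vcoker f) uv = 0.
Proof.
move=> f1; apply/lfunP => z; rewrite zero_lfunE; apply: val_inj.
by apply: (etrans (vcokerE _ _)); rewrite projv_id ?subrr.
Qed.

End KernelCokernel.

(** * Inclusions between free functors *)

Section Incl.
Variables (g h : T) (gh : (g <= h)%O).

Let incl_fun u : 'Hom(free_functor K h u, free_functor K g u) :=
  linfun (mulmxr (const_mx 1 : 'M[K]_((h <= u)%O, (g <= u)%O))).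

Let incl_funE u x :
  incl_fun u x = (x : 'rV[K]_(h <= u)%O) *m (const_mx 1 : 'M[K]_(_, _)).
Proof. by rewrite lfunE. Qed.

Let incl_natural u v (uv : (u <= v)%O) x :
  incl_fun v (vmap (free_functor K h) uv x) =
  vmap (free_functor K g) uv (incl_fun u x).
Proof.
rewrite incl_funE !free_functorE incl_funE -!mulmxA; congr mulmx.
rewrite !mul_const_mx1 // => hu.
  exact: le_trans gh hu.
exact: le_trans hu uv.
Qed.

Definition free_incl : vnat (free_functor K h) (free_functor K g) :=
  VNat incl_natural.

Lemma free_inclE u (x : free_functor K h u) :
  free_incl u x = (x : 'rV[K]_(h <= u)%O) *m (const_mx 1 : 'M[K]_(_, _)).
Proof. exact: incl_funE. Qed.

(** Where [h <= u], the all-ones matrix in the opposite direction is a left inverse; elsewhere the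
    source is zero. *)
Lemma free_incl_inj u (x : free_functor K h u) : free_incl u x = 0 -> x = 0.
Proof.
have [hu|hu] := boolP (h <= u)%O; last by rewrite (free_functor_eq0 x hu).
rewrite free_inclE => x0.
have := congr1 (fun z : 'rV[K]_(g <= u)%O =>
  z *m (const_mx 1 : 'M[K]_(_, (h <= u)%O))) x0.
rewrite /= mul0mx -mulmxA mul_const_mx1; last by move=> _; exact: le_trans gh hu.
by rewrite free_functor_id.
Qed.

Lemma free_incl_surj u (y : free_functor K g u) : (h <= u)%O ->
  y \in limg (free_incl u).
Proof.
move=> hu; apply/memv_imgP.
exists ((y : 'rV[K]_(g <= u)%O) *m (const_mx 1 : 'M[K]_(_, (h <= u)%O))).
  exact: memvf.
by rewrite free_inclE -mulmxA mul_const_mx1 // free_functor_id.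
Qed.

End Incl.

(** * Tameness of free functors *)

Section FreeTame.
Variable g : T.

Let F : vfunctor T K := free_functor K g.
Let F1 : vfunctor T K := free_sum K [:: g].

Let p : vnat (vzero T K) F1.
Proof.
by exists (fun u => 0) => u v h x; rewrite !zero_lfunE linear0.
Defined.

(** The zero map [p] has zero image, so the complement carrying its cokernel is the whole of [F1]:
    one generator and no relations present [F]. *)
Let projp u (y : F1 u) : projv (limg (p u)) y = 0.
Proof.
have := memv_proj (limg (p u)) y.
by case/memv_imgP => z _; rewrite zero_lfunE.
Qed.

Let to_fun u (x : F u) : vcoker p u := vsproj _ ((x, 0) : F1 u).

Let compl_full u (y : F1 u) : y \in ((limg (p u))^C)%VS.
Proof. by have := sub_projv_compl (limg (p u)) y; rewrite projp subr0. Qed.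

Let to_linear u : linear (@to_fun u).
Proof.
move=> a x y; apply: val_inj => /=.
rewrite /to_fun /= !vsprojK ?compl_full //.
by congr pair; rewrite /= scaler0 addr0.
Qed.

Let to_hom u : 'Hom(F u, vcoker p u) :=
  linfun (HB.pack (@to_fun u)
    (GRing.isLinear.Build _ _ _ _ _ (@to_linear u)) : {linear _ -> _}).

Let to_homE u x : vsval (to_hom u x) = (x, 0).
Proof. by rewrite lfunE /= /to_fun vsprojK ?compl_full. Qed.

Let to_natural u v (uv : (u <= v)%O) x :
  to_hom v (vmap F uv x) = vmap (vcoker p) uv (to_hom u x).
Proof.
apply: val_inj; apply: (etrans (to_homE _)); apply: esym.
by apply: (etrans (vcokerE _ _)); rewrite projp subr0 to_homE vsumE /= linear0.
Qed.

Let from_fun u (z : vcoker p u) : F u := (vsval z).1.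

Let from_linear u : linear (@from_fun u).
Proof. by []. Qed.

Let from_hom u : 'Hom(vcoker p u, F u) :=
  linfun (HB.pack (@from_fun u)
    (GRing.isLinear.Build _ _ _ _ _ (@from_linear u)) : {linear _ -> _}).

Let from_homE u z : from_hom u z = (vsval z).1.
Proof. by rewrite lfunE. Qed.

Let from_natural u v (uv : (u <= v)%O) z :
  from_hom v (vmap (vcoker p) uv z) = vmap F uv (from_hom u z).
Proof. by rewrite !from_homE vcokerE projp subr0 vsumE. Qed.

Lemma tame_free_functor : tame F.
Proof.
exists [::], [:: g], p, (VNat to_natural), (VNat from_natural).
split=> u x /=; first by rewrite from_homE to_homE.
apply: val_inj; rewrite /= to_homE from_homE; case: (vsval x) => a b /=.
by congr pair; apply/matrixP => i [].
Qed.

End FreeTame.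
End FreeFunctors.

(** * The distance between free functors in terms of the step function *)

Section ContourDistance.
Variables (R : realType) (l : nat) (K : fieldType) (c : contour R l).
Local Notation orth := (orthant R l).
Local Notation functor := (vfunctor orth K).
Implicit Types (u v w : orth) (s t k : {nonneg R}) (X Y Z : functor).

Definition step v w : \bar R :=
  ereal_inf [set (t%:num)%:E | t in
    [set t | leoo (Some w) (c (Some v) t)]]%classic.

Lemma step_le v w t : leoo (Some w) (c (Some v) t) -> (step v w <= t%:num%:E)%E.
Proof. by move=> wt; apply: ereal_inf_lbound; exists t. Qed.

Lemma step_ge0 v w : (0 <= step v w)%E.
Proof. by apply: le_ereal_inf_tmp => _ [t _ <-]; rewrite lee_fin. Qed.

Lemma step_lt v w (b : \bar R) : (step v w < b)%E ->
  exists2 t, leoo (Some w) (c (Some v) t) & (t%:num%:E < b)%E.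
Proof. by move=> /ereal_inf_lt[_ [t wt <-] tb]; exists t. Qed.

(** Infinity is absorbing by [act_ge], so through [act_lax] finiteness at time [s + t] passes to
    both stages of the two-step action. *)
Lemma act_lax_some v w s t : c (Some v) (s%:num + t%:num)%:nng = Some w ->
  exists u u', [/\ c (Some v) s = Some u, c (Some u) t = Some u',
    (v <= u)%O, (u <= u')%O & (u' <= w)%O].
Proof.
move=> e; have := act_lax c (Some v) s t; rewrite e.
have := act_ge c (Some v) s; case e1: (c (Some v) s) => [u|] /= vu.
  have := act_ge c (Some u) t.
  by case e2: (c (Some u) t) => [u'|] //= uu' u'w; exists u, u'.
by have := act_ge c None t; case: (c None t).
Qed.

(** * Relations between functors, and the lower bound *)

Section Links.

Definition push_closed X Y (L : forall u, X u -> Y u -> Prop) : Prop :=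
  forall u v (h : (u <= v)%O) x y,
    L u x y -> L v (vmap X h x) (vmap Y h y).

Record link X Y (L : forall u, X u -> Y u -> Prop) t k : Prop := Link {
  link_lift : forall v u (h : (v <= u)%O) x, c (Some v) t = Some u ->
    exists y, L u (vmap X h x) y;
  link_ker : forall v u (h : (v <= u)%O) x, c (Some v) k = Some u ->
    L v x 0 -> vmap X h x = 0 }.

(** Lifts are made first into [Y], then into [Z]. Kernels are traced backwards: the middle element
    dies after [k'], which leaves the first element related to zero, and that one dies after a
    further [k]. *)
Lemma link_comp X Y Z (L : forall u, X u -> Y u -> Prop)
    (L' : forall u, Y u -> Z u -> Prop) t k t' k' :
  push_closed L -> push_closed L' -> link L t k -> link L' t' k' ->
  link (fun u x z => exists2 y, L u x y & L' u y z)
    (t%:num + t'%:num)%:nng (k'%:num + k%:num)%:nng.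
Proof.
move=> pL pL' lL lL'; split=> v w vw x /act_lax_some[u [u' [e e' vu uu' u'w]]].
  have [y Ly] := link_lift lL vu x e.
  have [z Lz] := link_lift lL' uu' y e'.
  exists (vmap Z u'w z), (vmap Y u'w (vmap Y uu' y)); last exact: pL'.
  rewrite -(vmap_comp (le_trans vu uu') u'w) -(vmap_comp vu uu').
  by do 2 apply: (pL).
move=> [y Lxy Lyz]; have y0 := link_ker lL' vu e Lyz.
have := pL _ _ vu _ _ Lxy; rewrite y0 => /(link_ker lL uu' e') x0.
by rewrite -(vmap_comp (le_trans vu uu') u'w) -(vmap_comp vu uu') x0 linear0.
Qed.

(** One relation is linked together with its converse, which makes the notion symmetric: backward
    arrows of a zig-zag are treated like forward ones. *)
Definition interleaved X Y (q : R) : Prop :=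
  exists L : forall u, X u -> Y u -> Prop, push_closed L /\
  exists t k t' k', [/\ link L t k, link (fun u y x => L u x y) t' k' &
    q = t%:num + k%:num + (t'%:num + k'%:num)].

Lemma interleaved_sym X Y q : interleaved X Y q -> interleaved Y X q.
Proof.
move=> [L [pL [t [k [t' [k' [lL lL' ->]]]]]]].
exists (fun u y x => L u x y); split; first by move=> u v h y x /(pL _ _ h).
by exists t', k', t, k; rewrite addrC.
Qed.

Lemma interleaved_trans X Y Z p q :
  interleaved X Y p -> interleaved Y Z q -> interleaved X Z (p + q).
Proof.
move=> [L [pL [t [k [t' [k' [lL lL' ->]]]]]]].
move=> [M [pM [s [j [s' [j' [lM lM' ->]]]]]]].
exists (fun u x z => exists2 y, L u x y & M u y z); split.
  move=> u v h x z [y Lxy Myz]; exists (vmap Y h y); first exact: pL.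
  exact: pM.
exists (t%:num + s%:num)%:nng, (j%:num + k%:num)%:nng.
exists (s'%:num + t'%:num)%:nng, (k'%:num + j'%:num)%:nng.
split; first exact: link_comp.
  have pL' : push_closed (fun u y x => L u x y) by move=> u v h x y /(pL _ _ h).
  have pM' : push_closed (fun u y x => M u x y) by move=> u v h x y /(pM _ _ h).
  (* The composite of the converses lists its two conditions in the opposite order, so both fields
     are repackaged. *)
  have [lift ker] := link_comp pM' pL' lM' lL'.
  split=> [v u h z /(lift _ _ h z)[x [y ? ?]]|v u h x /(ker _ _ h x) + [y ? ?]].
    by exists x, y.
  by apply; exists y.
by rewrite /=; ring.
Qed.

Lemma interleaved_refl X : interleaved X X 0.
Proof.
exists (fun u x y => x = y); split; first by move=> u v h x y ->.
exists 0%:nng, 0%:nng, 0%:nng, 0%:nng; split; last by rewrite /= !addr0.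
  split=> v u h x _; first by exists (vmap X h x).
  by move=> ->; rewrite linear0.
split=> v u h x _; first by exists (vmap X h x).
by move=> <-; rewrite linear0.
Qed.

Definition norm_bound X t : Prop := forall v u (h : (v <= u)%O),
  c (Some v) t = Some u -> vmap X h = 0.

(** The relation is the graph of [f]. Forwards, lifting is free and the kernel costs [a]; backwards,
    lifting costs [b] through the cokernel, and only zero is related to zero. *)
Lemma interleaved_hom X Y (f : vnat X Y) a b :
  norm_bound (vker f) a -> norm_bound (vcoker f) b ->
  interleaved X Y (a%:num + b%:num).
Proof.
move=> na nb; exists (fun u x y => f u x = y); split.
  by move=> u v h x y <-; rewrite vnatural.
exists 0%:nng, a, b, 0%:nng; split; last by rewrite /= add0r addr0.
  split=> v u h x e; first by exists (f u (vmap X h x)).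
  by move=> fx; apply: vmap_vker_eq0 fx; exact: na e.
split=> v u h y e; last by move=> <-; rewrite !linear0.
have /memv_imgP[x _ xE] := vmap_vcoker_img y (nb _ _ h e).
by exists x.
Qed.

Lemma functor_norm_le X t : norm_bound X t -> (functor_norm c X <= t%:num%:E)%E.
Proof. by move=> Xt; apply: ereal_inf_lbound; exists t. Qed.

Lemma functor_norm_ge0 X : (0 <= functor_norm c X)%E.
Proof. by apply: le_ereal_inf_tmp => _ [t _ <-]; rewrite lee_fin. Qed.

(** The slack in a strict inequality is enough to replace the infimum by an actual bound [t] while
    [b] stays strictly below what remains of [r]. *)
Lemma functor_norm_lt X (b : \bar R) (r : R) :
  (functor_norm c X + b < r%:E)%E -> (0 <= b)%E ->
  exists2 t, norm_bound X t & (b < (r - t%:num)%:E)%E.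
Proof.
case: b => [b||] //= Xb b0; last first.
  move: Xb; rewrite addey ?ltey //.
  by rewrite -ltNye (lt_le_trans _ (functor_norm_ge0 X)).
have : (functor_norm c X < (r - b)%:E)%E by rewrite EFinB lteBrDr.
move=> /ereal_inf_lt[_ [t Xt <-] tb]; exists t => //.
by move: tb; rewrite !lte_fin !ltrBrDr addrC.
Qed.

Lemma hom_norm_ge0 X Y (f : vnat X Y) : (0 <= hom_norm c f)%E.
Proof. by rewrite adde_ge0 ?functor_norm_ge0. Qed.

Lemma hom_norm_lt X Y (f : vnat X Y) (b : \bar R) (r : R) :
  (hom_norm c f + b < r%:E)%E -> (0 <= b)%E ->
  exists2 q, interleaved X Y q & (b < (r - q)%:E)%E.
Proof.
rewrite -addeA => fb b0.
have [s ns] := functor_norm_lt fb (adde_ge0 (functor_norm_ge0 _) b0).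
move=> /functor_norm_lt /(_ b0)[t nt bt].
exists (s%:num + t%:num); first exact: interleaved_hom ns nt.
by rewrite opprD addrA.
Qed.

Lemma zigzag_ge0 X Y (r : \bar R) : zigzag c X Y r -> (0 <= r)%E.
Proof. elim=> [//|W0 W1 W2 Z b f1 f2 _ _ _ b0].
by do 2![apply: adde_ge0; first exact: hom_norm_ge0]. Qed.

(** Induction on the zig-zag with [r] varying, since the share of each arrow is subtracted from [r]
    before the rest is treated. *)
Lemma zigzag_interleaved X Y (b : \bar R) (r : R) :
  zigzag c X Y b -> (b < r%:E)%E -> exists2 q, interleaved X Y q & q < r.
Proof.
move=> z; elim: z r => [{}X _ r r0|W0 W1 W2 Z {}b f1 f2 _ _ z IH r].
  by exists 0; [exact: interleaved_refl|rewrite -lte_fin].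
have b0 := zigzag_ge0 z.
move=> /hom_norm_lt /(_ (adde_ge0 (hom_norm_ge0 f2) b0))[q1 i1].
move=> /hom_norm_lt /(_ b0)[q2 i2] /IH[q3 i3 lt3].
exists (q1 + (q2 + q3)); last by rewrite -ltrBrDl -ltrBrDl.
by apply: interleaved_trans i1 (interleaved_trans (interleaved_sym i2) i3).
Qed.

(** If [w] is not below the point reached from [v] at time [t], the second functor vanishes there.
    The generator is then related to zero and must die, which it never does. *)
Lemma link_free v w
    (L : forall u, free_functor K v u -> free_functor K w u -> Prop) t k :
  push_closed L -> link L t k ->
  leoo (Some w) (c (Some v) (t%:num + k%:num)%:nng).
Proof.
move=> pL lL; case e: (c _ _) => [u'|] //.
have [u [u2 [e1 e2 vu uu2 u2u']]] := act_lax_some e.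
have [wu|wu] := boolP (w <= u)%O; first exact: le_trans wu (le_trans uu2 u2u').
have [y Ly] := link_lift lL vu (free_gen K v v) e1.
have y0 := free_functor_eq0 y wu; rewrite {}y0 in Ly.
have := link_ker lL uu2 e2 Ly; rewrite (vmap_comp _ _ (le_trans vu uu2)).
by move=> /(vmap_free_gen (lexx v)).
Qed.

Lemma step_le_interleaved v w q :
  interleaved (free_functor K v) (free_functor K w) q ->
  (step v w + step w v <= q%:E)%E.
Proof.
move=> [L [pL [t [k [t' [k' [lL lL' ->]]]]]]]; rewrite EFinD.
apply: leeD; apply: (@step_le _ _ (_ + _)%:nng).
  exact: link_free lL.
by apply: link_free lL' => a b h x y /(pL _ _ h).
Qed.

End Links.

(** * Norms of identities and inclusions, and the upper bound *)

Lemma functor_norm_zero X :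
  (forall v u (h : (v <= u)%O), vmap X h = 0) -> functor_norm c X = 0%E.
Proof.
move=> X0; apply/eqP; rewrite eq_le functor_norm_ge0 andbT.
by apply: (@functor_norm_le _ 0%:nng) => v u h _.
Qed.

Lemma functor_norm_vker0 X Y (f : vnat X Y) :
  (forall u x, f u x = 0 -> x = 0) -> functor_norm c (vker f) = 0%E.
Proof.
by move=> f0; apply: functor_norm_zero => v u h; exact: vmap_vker0 (f0 v).
Qed.

Lemma hom_norm_id X : hom_norm c (vnat_id X) = 0%E.
Proof.
rewrite /hom_norm functor_norm_vker0 ?add0e; last first.
  by move=> u x; rewrite id_lfunE.
apply: functor_norm_zero => v u h; apply: vmap_vcoker0 => y.
by rewrite lim1g memvf.
Qed.

(** The inclusion is injective, so only its cokernel counts. Above [v], monotonicity carries every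
    point past [w] in time [t], hence past [j], where the inclusion is onto. Bounding [j] by the
    join lets the lemma apply with [v] and [w] exchanged. *)
Lemma hom_norm_free_incl v w j (h : (v <= j)%O) : (j <= v `|` w)%O ->
  (hom_norm c (free_incl K h) <= step v w)%E.
Proof.
move=> jvw; rewrite /hom_norm functor_norm_vker0 ?add0e; last first.
  by move=> u x; exact: free_incl_inj.
apply: le_ereal_inf_tmp => _ [t wt <-]; apply: functor_norm_le => v0 u v0u e.
apply: vmap_vcoker0 => y.
have [vv0|vv0] := boolP (v <= v0)%O.
  apply: free_incl_surj; apply: le_trans jvw _; rewrite leUx (le_trans vv0 v0u) /=.
  have := @act_mono _ _ c (Some v) (Some v0) t t vv0 (lexx t).
  by rewrite e => /(leoo_trans wt).
by rewrite (free_functor_eq0 y vv0) linear0 mem0v.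
Qed.

Lemma orthant_distE v w : orthant_dist K c v w = (step v w + step w v)%E.
Proof.
apply/eqP; rewrite eq_le; apply/andP; split; last first.
  apply: le_ereal_inf_tmp => b z; apply/lee_addgt0Pr => e e0.
  have := zigzag_ge0 z; case: b z => [b||] z //= _; last first.
    by rewrite addye ?leey.
  have [|q iq qb] := @zigzag_interleaved _ _ _ (b + e) z.
    by rewrite lte_fin ltrDl.
  by apply: le_trans (step_le_interleaved iq) _; rewrite -EFinD lee_fin ltW.
have vj : (v <= v `|` w)%O by rewrite leUl.
have wj : (w <= v `|` w)%O by rewrite leUr.
have tame_free u : tame (free_functor K u) := tame_free_functor K u.
(* [zigzag_cons] adds a forward and a backward arrow at once, so identities of norm zero pad both
   ends. *)
have z := zigzag_cons (vnat_id _) (free_incl K vj) (tame_free v) (tame_free v)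
  (zigzag_cons (free_incl K wj) (vnat_id _) (tame_free _) (tame_free w)
    (zigzag_nil c (tame_free w))).
apply: le_trans (ereal_inf_lbound z) _ => {z}.
rewrite -[leRHS]add0e.
apply: leeD; first by rewrite hom_norm_id.
apply: leeD; first exact: hom_norm_free_incl.
rewrite -[leRHS]adde0; apply: leeD; last by rewrite hom_norm_id adde0.
by apply: hom_norm_free_incl; rewrite leUx leUr leUl.
Qed.

End ContourDistance.

(** * Comparison of step functions for the four constructions *)

Section Constructions.
Variables (R : realType) (l : nat) (K : fieldType) (c : contour R l).
Implicit Types (v w : orthant R l) (t : {nonneg R}) (C D : R).

Lemma dinfty_ge0 v w : 0 <= dinfty v w.
Proof.
by rewrite /dinfty; elim/big_rec: _ => // i x _ x0; rewrite le_max x0 orbT.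
Qed.

Lemma orthant_dist_ge0 v w : (0 <= orthant_dist K c v w)%E.
Proof. by rewrite orthant_distE adde_ge0 ?step_ge0. Qed.

Lemma le_step (c' : contour R l) v w v' w' :
  (forall t, leoo (Some w) (c (Some v) t) ->
     leoo (Some w') (c' (Some v') t)) ->
  (step c' v' w' <= step c v w)%E.
Proof.
by move=> cc'; apply: le_ereal_inf_tmp => _ [t /cc' wt <-]; exact: step_le.
Qed.

Section Dominated.
Variable c' : contour R l.
Hypothesis cc' : forall v t, leoo (c (Some v) t) (c' (Some v) t).

(** A larger action reaches every target no later. Truncation and join both enlarge the action. *)
Lemma le_orthant_dist v w : (orthant_dist K c' v w <= orthant_dist K c v w)%E.
Proof.
by rewrite !orthant_distE leeD //; apply: le_step => t /leoo_trans; apply.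
Qed.

Lemma continuous_dominated : continuous_contour K c -> continuous_contour K c'.
Proof.
move=> cc v e /(cc v)[b b0 cb]; exists b => // w /cb.
exact: le_lt_trans (le_orthant_dist v w).
Qed.

Lemma lipschitz_dominated C : lipschitz_contour K c C -> lipschitz_contour K c' C.
Proof. by move=> cC v w; apply: le_trans (le_orthant_dist v w) (cC v w). Qed.

End Dominated.

Lemma leoo_trunc (G : {fset orthant R l}) v t :
  leoo (c (Some v) t) (contour_trunc G c (Some v) t).
Proof.
rewrite /= /trunc_act; case: ifP => _; last exact: leoo_refl.
by case: (c _ _).
Qed.

Lemma leoo_joinc (x : orthantoo R l) v t :
  leoo (c (Some v) t) (contour_join x c (Some v) t).
Proof. by apply: act_mono => //; exact: leoo_joinl. Qed.

Section Conjugation.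
Variable phi : order_iso R l.

Lemma step_conj v w : step (contour_conj phi c) v w = step c (phi v) (phi w).
Proof.
have E t : leoo (Some w) (contour_conj phi c (Some v) t) =
    leoo (Some (phi w)) (c (Some (phi v)) t).
  rewrite /= /conj_act /=; case: (c _ _) => [u|] //=.
  by rewrite -(iso_le phi) iso_invK.
by rewrite /step; congr (ereal_inf (image _ _)); apply/funext => t; rewrite /mkset E.
Qed.

Lemma orthant_dist_conj v w :
  orthant_dist K (contour_conj phi c) v w = orthant_dist K c (phi v) (phi w).
Proof. by rewrite !orthant_distE !step_conj. Qed.

Lemma continuous_conj :
  continuous_contour K c -> continuous_wrt (@edinfty R l) (@edinfty R l) phi ->
  continuous_contour K (contour_conj phi c).
Proof.
move=> cc cphi v e /(cc (phi v))[b /(cphi v)[a a0 ab] bc]; exists a => // w /ab /bc.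
by rewrite orthant_dist_conj.
Qed.

Lemma lipschitz_conj C D : lipschitz_contour K c C -> lipschitz_dinfty D phi ->
  lipschitz_contour K (contour_conj phi c) (C * D).
Proof.
move=> cC phiD v w; rewrite orthant_dist_conj.
have := cC (phi v) (phi w); have := phiD v w.
have [C0|C0] := leP 0 C.
  move=> le1 /le_trans; apply; rewrite lee_fin -mulrA.
  exact: ler_wpM2l.
(* A negative Lipschitz constant forces all distances to vanish. *)
have d0 (x y : orthant R l) : dinfty x y = 0.
  apply/eqP; rewrite eq_le dinfty_ge0 andbT -(nmulr_rge0 _ C0) -lee_fin.
  exact: le_trans (orthant_dist_ge0 x y) (cC x y).
by rewrite !d0 !mulr0.
Qed.

End Conjugation.

Section Reparametrization.
Variables (f : {nonneg R} -> \bar R) (hf : contour_type f).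

Lemma step_repar_le v w s t : leoo (Some w) (c (Some v) s) ->
  (s%:num%:E <= f t)%E -> (step (contour_repar hf c) v w <= t%:num%:E)%E.
Proof.
move=> ws sf; apply: step_le; rewrite /= /repar_act; case: ifPn => // ft.
apply: leoo_trans ws _; apply: act_mono; first exact: leoo_refl.
rewrite -num_le /= -lee_fin fineK //.
by rewrite ge0_fin_numE ?ctype_ge0 // lt_neqAle ft leey.
Qed.

Lemma continuous_repar : continuous_contour K c ->
  (forall t, 0 < t%:num -> (0 < f t)%E) ->
  continuous_contour K (contour_repar hf c).
Proof.
(* Here [t] is [e / 3]: two steps of at most this size stay strictly below [e]. *)
move=> cc f0 v e e0; pose t := NngNum (ltW (divr_gt0 e0 (ltr0Sn R 2))).
have ft0 : (0 < f t)%E by apply: f0; rewrite divr_gt0.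
(* [f t] may be infinite; a positive real below it is then chosen as 1. *)
have [a a0 af] : exists2 a : R, 0 < a & (a%:E <= f t)%E.
  case: (f t) ft0 => [a||] //; first by exists a.
  by exists 1; rewrite ?leey.
have [b b0 cb] := cc v a a0; exists b => // w /cb.
rewrite /= !orthant_distE => lta.
have half x y : (step c x y < a%:E)%E ->
    (step (contour_repar hf c) x y <= (e / 3)%:E)%E.
  move=> /step_lt[s ys sa].
  by apply: (@step_repar_le _ _ s t) => //; exact: le_trans (ltW sa) af.
apply: (@le_lt_trans _ _ ((e / 3)%:E + (e / 3)%:E)%E).
  apply: leeD; apply: half; apply: le_lt_trans lta.
    by rewrite leeDl ?step_ge0.
  by rewrite leeDr ?step_ge0.
by rewrite -EFinD lte_fin; lra.
Qed.

Lemma lipschitz_repar C D : lipschitz_contour K c C ->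
  (forall t, 0 < t%:num -> (t%:num%:E <= D%:E * f t)%E) ->
  lipschitz_contour K (contour_repar hf c) (C * D).
Proof.
move=> cC fD.
(* At time 1 the hypothesis reads [1 <= D * f 1] with [f 1] non-negative. *)
have D0 : 0 < D.
  rewrite ltNge; apply/negP => D0.
  have := fD (NngNum (@ler01 R)) ltr01; rewrite leNgt => /negP; apply.
  apply: (@le_lt_trans _ _ 0%E); last by rewrite lte_fin.
  by apply: mule_le0_ge0; [rewrite lee_fin|exact: ctype_ge0].
have stepD v w : (step (contour_repar hf c) v w <= D%:E * step c v w)%E.
  rewrite -lee_pdivrMl //; apply: le_ereal_inf_tmp => _ [s ws <-].
  rewrite lee_pdivrMl //; apply/lee_addgt0Pr => e e0.
  (* Adding [e] makes the time positive even for [s = 0], as [fD] requires; then [D * f t] is at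
     least [D * s], and [D] cancels. *)
  have t0 : 0 <= D * s%:num + e by rewrite addr_ge0 ?mulr_ge0 // ltW.
  rewrite -EFinM -EFinD; apply: (step_repar_le (t := NngNum t0) ws).
  rewrite -(@lee_pmul2l _ D%:E) ?lte_fin //.
  apply: le_trans (fD _ _) => /=; last by rewrite ltr_wpDl ?mulr_ge0 // ltW.
  by rewrite -EFinM lee_fin lerDl ltW.
move=> v w; rewrite orthant_distE.
apply: le_trans (leeD (stepD v w) (stepD w v)) _.
rewrite -ge0_muleDr ?step_ge0 // -(orthant_distE K) mulrAC mulrC EFinM.
by apply: lee_pmul => //; [rewrite lee_fin ltW|exact: orthant_dist_ge0].
Qed.

End Reparametrization.

End Constructions.

Theorem proposition9p7 (R : realType) (l : nat) (K : fieldType)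
    (c : contour R l) :
  (forall phi : order_iso R l,
     (continuous_contour K c ->
      continuous_wrt (@edinfty R l) (@edinfty R l) phi ->
      continuous_contour K (contour_conj phi c)) /\
     (forall C D : R, lipschitz_contour K c C -> lipschitz_dinfty D phi ->
      lipschitz_contour K (contour_conj phi c) (C * D))) /\
  (forall G : {fset orthant R l},
     (continuous_contour K c -> continuous_contour K (contour_trunc G c)) /\
     (forall C : R, lipschitz_contour K c C ->
      lipschitz_contour K (contour_trunc G c) C)) /\
  (forall x : orthantoo R l,
     (continuous_contour K c -> continuous_contour K (contour_join x c)) /\
     (forall C : R, lipschitz_contour K c C ->
      lipschitz_contour K (contour_join x c) C)) /\
  (forall (f : {nonneg R} -> \bar R) (hf : contour_type f),
     (continuous_contour K c ->
      (forall t : {nonneg R}, 0 < t%:num -> (0 < f t)%E) ->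
      continuous_contour K (contour_repar hf c)) /\
     (forall C D : R, lipschitz_contour K c C ->
      (forall t : {nonneg R}, 0 < t%:num -> ((t%:num)%:E <= D%:E * f t)%E) ->
      lipschitz_contour K (contour_repar hf c) (C * D))).
Proof.
split; first by move=> phi; split; [exact: continuous_conj|exact: lipschitz_conj].
split.
  move=> G; split; first exact/continuous_dominated/leoo_trunc.
  exact/lipschitz_dominated/leoo_trunc.
split; last by move=> f hf; split; [exact: continuous_repar|exact: lipschitz_repar].
move=> x; split; first exact/continuous_dominated/leoo_joinc.
exact/lipschitz_dominated/leoo_joinc.
Qed.
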